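(* If $\mathsf{Kt}2\vdash A$ then $\mathsf{IKt}2\vdash A^N$.
   Context: Formulas: $A ::= P \mid X \mid A\to B \mid \Box A \mid \blacksquare A \mid \forall X A$, with $\bot := \forall XX$, $\neg A := A\to\bot$, $\Diamond A := \forall X(\Box(A\to\blacksquare X)\to X)$, backward diamond $\Diamond^{\bullet}A := \forall X(\blacksquare(A\to\Box X)\to X)$. $\mathsf{IKt}2$: second-order intuitionistic propositional logic (with full comprehension $\forall XA\to A[C/X]$, modus ponens, generalisation with fresh propositional symbol), distribution axioms $\Box(A\to B)\to\Box A\to\Box B$, $\Box(A\to B)\to\Diamond A\to\Diamond B$, $\blacksquare(A\to B)\to\blacksquare A\to\blacksquare B$, $\blacksquare(A\to B)\to\Diamond^{\bullet}A\to\Diamond^{\bullet}B$, necessitation for $\Box$ and $\blacksquare$, tense axioms $\Diamond^{\bullet}\Box A\to A$, $A\to\Box\Diamond^{\bullet}A$, $\Diamond\blacksquare A\to A$, $A\to\blacksquare\Diamond A$; $\mathsf{Kt}2 := \mathsf{IKt}2+(\neg\neg A\to A)$. The negative (Gödel–Gentzen) translation: $P^N := \neg\neg P$, $X^N := \neg\neg X$, $(A\to B)^N := A^N\to B^N$, $(\Box A)^N := \Box A^N$, $(\blacksquare A)^N := \blacksquare A^N$, $(\forall XA)^N := \forall X A^N$. *)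

(* Defs.v *)
(** Formulas: propositional symbols are named by natural numbers, and
    second-order variables are de Bruijn indices, so that alpha-equivalent
    formulas are equal and substitution is capture-avoiding. *)
Inductive form : Type :=
| Sym : nat -> form
| Var : nat -> form
| Imp : form -> form -> form
| Box : form -> form
| BBox : form -> form            (* the backward box *)
| All : form -> form.            (* binds index 0 *)

Declare Scope form_scope.
Delimit Scope form_scope with form.
Bind Scope form_scope with form.
Notation "A --> B" := (Imp A B) (at level 55, right associativity) : form_scope.
Local Open Scope form_scope.

Definition up_ren (r : nat -> nat) (n : nat) : nat :=
  match n with 0 => 0 | S m => S (r m) end.

Fixpoint ren (r : nat -> nat) (A : form) : form :=
  match A with
  | Sym p => Sym p
  | Var n => Var (r n)
  | A --> B => ren r A --> ren r B
  | Box A => Box (ren r A)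
  | BBox A => BBox (ren r A)
  | All A => All (ren (up_ren r) A)
  end.

(** [shift A] is [A] seen in the scope of one more quantifier, whose variable
    does not occur in it. *)
Definition shift (A : form) : form := ren S A.

Definition up (s : nat -> form) (n : nat) : form :=
  match n with 0 => Var 0 | S m => shift (s m) end.

Fixpoint subst (s : nat -> form) (A : form) : form :=
  match A with
  | Sym p => Sym p
  | Var n => s n
  | A --> B => subst s A --> subst s B
  | Box A => Box (subst s A)
  | BBox A => BBox (subst s A)
  | All A => All (subst (up s) A)
  end.

(** [inst A C] is A[C/X], where X is the variable bound by the quantifier of
    [All A]. *)
Definition inst (A C : form) : form :=
  subst (fun n => match n with 0 => C | S m => Var m end) A.

Fixpoint occurs (p : nat) (A : form) : Prop :=
  match A with
  | Sym q => p = q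
  | Var _ => False
  | A --> B => occurs p A \/ occurs p B
  | Box A => occurs p A
  | BBox A => occurs p A
  | All A => occurs p A
  end.

Definition Bot : form := All (Var 0).
Definition Neg (A : form) : form := A --> Bot.
Definition Dia (A : form) : form :=
  All (Box (shift A --> BBox (Var 0)) --> Var 0).
Definition BDia (A : form) : form :=
  All (BBox (shift A --> Box (Var 0)) --> Var 0).

(** Derivability in IKt2 extended with the axioms [Ax]. The first four
    constructors together with [d_mp] axiomatise second-order intuitionistic
    propositional logic over implication and the quantifier: K, S, full
    comprehension, and generalisation over a fresh propositional symbol, the
    latter with a side formula [A] so that no separate axiom is needed to move
    the quantifier across an implication. *)
Inductive deriv (Ax : form -> Prop) : form -> Prop :=
| d_k (A B : form) : deriv Ax (A --> B --> A)
| d_s (A B C : form) :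
    deriv Ax ((A --> B --> C) --> (A --> B) --> A --> C)
| d_comp (A C : form) : deriv Ax (All A --> inst A C)
| d_gen (p : nat) (A B : form) :
    ~ occurs p A -> ~ occurs p B ->
    deriv Ax (A --> inst B (Sym p)) -> deriv Ax (A --> All B)
| d_mp (A B : form) : deriv Ax (A --> B) -> deriv Ax A -> deriv Ax B
| d_box_k (A B : form) : deriv Ax (Box (A --> B) --> Box A --> Box B)
| d_dia_k (A B : form) : deriv Ax (Box (A --> B) --> Dia A --> Dia B)
| d_bbox_k (A B : form) : deriv Ax (BBox (A --> B) --> BBox A --> BBox B)
| d_bdia_k (A B : form) : deriv Ax (BBox (A --> B) --> BDia A --> BDia B)
| d_box_nec (A : form) : deriv Ax A -> deriv Ax (Box A)
| d_bbox_nec (A : form) : deriv Ax A -> deriv Ax (BBox A)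
| d_bdia_box (A : form) : deriv Ax (BDia (Box A) --> A)
| d_box_bdia (A : form) : deriv Ax (A --> Box (BDia A))
| d_dia_bbox (A : form) : deriv Ax (Dia (BBox A) --> A)
| d_bbox_dia (A : form) : deriv Ax (A --> BBox (Dia A))
| d_ax (A : form) : Ax A -> deriv Ax A.

Definition IKt2 : form -> Prop := deriv (fun _ => False).

Definition Kt2 : form -> Prop :=
  deriv (fun F => exists A : form, F = (Neg (Neg A) --> A)).

Fixpoint negtr (A : form) : form :=
  match A with
  | Sym p => Neg (Neg (Sym p))
  | Var n => Neg (Neg (Var n))
  | A --> B => negtr A --> negtr B
  | Box A => Box (negtr A)
  | BBox A => BBox (negtr A)
  | All A => All (negtr A)
  end.

(* Main.v *)
(** Every negative formula is stable: [~~A^N -> A^N] is derivable.  The modal case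
    is [~~Box A -> Box ~~A], obtained from the adjunction between [BDia] and [Box]:
    [Dia ~A] refutes [Box A], so [~A -> BBox (Dia ~A)] gives
    [~A -> BBox ~~~Box A], hence [BDia (~~Box A)] refutes [~A].  By stability,
    [A[C/X]^N] is equivalent to [A^N[C^N/X]], which interprets comprehension.

    Generalisation allows a single side formula and there is no conjunction; two
    side formulas [D], [E] are merged into [~(D -> ~E)], which entails the same
    stable formulas. *)
Require Import Defs.
From Stdlib Require Import List Lia.
Import ListNotations.
Local Open Scope form_scope.

(** * Substitution calculus for de Bruijn indices *)

Definition scons (C : form) (s : nat -> form) (n : nat) : form :=
  match n with 0 => C | S m => s m end.

Lemma subst_ext (s t : nat -> form) (A : form) :
  (forall n, s n = t n) -> subst s A = subst t A.
Proof.
  revert s t; induction A as [p|n|A IHA B IHB|A IHA|A IHA|A IHA];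
    intros s t H; simpl; auto; f_equal; auto.
  apply IHA; intros [|n]; simpl; [reflexivity|now rewrite H].
Qed.

Lemma ren_as_subst (r : nat -> nat) (A : form) :
  ren r A = subst (fun n => Var (r n)) A.
Proof.
  revert r; induction A as [p|n|A IHA B IHB|A IHA|A IHA|A IHA];
    intros r; simpl; auto; f_equal; auto.
  rewrite IHA; apply subst_ext; now intros [|n].
Qed.

Lemma subst_ren (r : nat -> nat) (s : nat -> form) (A : form) :
  subst s (ren r A) = subst (fun n => s (r n)) A.
Proof.
  revert r s; induction A as [p|n|A IHA B IHB|A IHA|A IHA|A IHA];
    intros r s; simpl; auto; f_equal; auto.
  rewrite IHA; apply subst_ext; now intros [|n].
Qed.

Lemma subst_var (A : form) : subst Var A = A.
Proof.
  induction A as [p|n|A IHA B IHB|A IHA|A IHA|A IHA]; simpl; auto; f_equal; auto.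
  rewrite <- IHA at 2; apply subst_ext; now intros [|n].
Qed.

Lemma ren_ren (r r' : nat -> nat) (A : form) :
  ren r' (ren r A) = ren (fun n => r' (r n)) A.
Proof. rewrite (ren_as_subst r'), subst_ren; symmetry; apply ren_as_subst. Qed.

Lemma ren_subst (r : nat -> nat) (s : nat -> form) (A : form) :
  ren r (subst s A) = subst (fun n => ren r (s n)) A.
Proof.
  revert r s; induction A as [p|n|A IHA B IHB|A IHA|A IHA|A IHA];
    intros r s; simpl; auto; f_equal; auto.
  rewrite IHA; apply subst_ext; intros [|n]; simpl; auto.
  unfold shift; now rewrite !ren_ren.
Qed.

Lemma subst_subst (s t : nat -> form) (A : form) :
  subst t (subst s A) = subst (fun n => subst t (s n)) A.
Proof.
  revert s t; induction A as [p|n|A IHA B IHB|A IHA|A IHA|A IHA];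
    intros s t; simpl; auto; f_equal; auto.
  rewrite IHA; apply subst_ext; intros [|n]; simpl; auto.
  unfold shift; now rewrite subst_ren, ren_subst.
Qed.

Lemma inst_shift (A C : form) : inst (shift A) C = A.
Proof.
  unfold inst, shift; rewrite subst_ren; apply subst_var.
Qed.

Lemma inst_subst_up (s : nat -> form) (A C : form) :
  inst (subst (up s) A) C = subst (scons C s) A.
Proof.
  unfold inst; rewrite subst_subst; apply subst_ext; intros [|n]; simpl; auto.
  apply (inst_shift (s n) C).
Qed.

(** * Fresh propositional symbols *)

Lemma fresh_exists (A : form) :
  exists k, forall p, k <= p -> ~ occurs p A.
Proof.
  induction A as [q|n|A [k HA] B [l HB]|A IHA|A IHA|A IHA]; simpl; auto.
  - exists (S q); intros; lia.
  - exists 0; auto.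
  - exists (k + l); intros p Hp [H|H]; [apply (HA p)|apply (HB p)]; auto; lia.
Qed.

Lemma fresh2 (A B : form) : exists p, ~ occurs p A /\ ~ occurs p B.
Proof.
  destruct (fresh_exists (A --> B)) as [p H]; exists p.
  specialize (H p (le_n p)); simpl in H; tauto.
Qed.

Lemma occurs_negtr (p : nat) (A : form) : occurs p (negtr A) -> occurs p A.
Proof. induction A; simpl; tauto. Qed.

(** * Deduction from hypotheses *)

Inductive ent (G : list form) : form -> Prop :=
| ent_hyp (A : form) : In A G -> ent G A
| ent_thm (A : form) : IKt2 A -> ent G A
| ent_mp (A B : form) : ent G (A --> B) -> ent G A -> ent G B.

Lemma IKt2_refl (A : form) : IKt2 (A --> A).
Proof.
  apply d_mp with (A --> A --> A); [|apply d_k].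
  apply d_mp with (A --> (A --> A) --> A); [apply d_s|apply d_k].
Qed.

(** Necessitation and generalisation enter [ent] only through theorems, never below a hypothesis, so
    K and S suffice for the deduction theorem. *)
Lemma ent_intro (G : list form) (A B : form) : ent (A :: G) B -> ent G (A --> B).
Proof.
  induction 1 as [B [<-|H]|B H|B C _ IH1 _ IH2].
  - apply ent_thm, IKt2_refl.
  - eapply ent_mp; [apply ent_thm, d_k|now apply ent_hyp].
  - eapply ent_mp; [apply ent_thm, d_k|now apply ent_thm].
  - eapply ent_mp; [eapply ent_mp; [apply ent_thm, d_s|]|]; eassumption.
Qed.

Lemma ent_nil (A : form) : ent [] A -> IKt2 A.
Proof.
  induction 1 as [A []|A H|A B _ IH1 _ IH2]; [assumption|].
  now apply d_mp with A.
Qed.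

Ltac intro_all := apply ent_nil; repeat (apply ent_intro).
Ltac in_list := solve [left; reflexivity | right; in_list].
Ltac hyp := solve [apply ent_hyp; in_list].
Ltac by_mp A := apply ent_mp with A; [try hyp | try hyp].
Ltac by_thm H := eapply ent_mp; [apply ent_thm, H | try hyp].

Lemma imp_trans (A B C : form) : IKt2 (A --> B) -> IKt2 (B --> C) -> IKt2 (A --> C).
Proof. intros H K; intro_all. by_thm K. by_thm H. Qed.

Lemma bot_elim (C : form) : IKt2 (Bot --> C).
Proof. exact (d_comp _ (Var 0) C). Qed.

Lemma dneg_intro (A : form) : IKt2 (A --> Neg (Neg A)).
Proof. intro_all. by_mp A. Qed.

Lemma contrapose (A B : form) : IKt2 (A --> B) -> IKt2 (Neg B --> Neg A).
Proof. intros H; intro_all. by_mp B. by_thm H. Qed.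

(** * Monotone modalities *)

Lemma box_mono (A B : form) : IKt2 (A --> B) -> IKt2 (Box A --> Box B).
Proof. intro H; eapply d_mp; [apply d_box_k|now apply d_box_nec]. Qed.

Lemma bbox_mono (A B : form) : IKt2 (A --> B) -> IKt2 (BBox A --> BBox B).
Proof. intro H; eapply d_mp; [apply d_bbox_k|now apply d_bbox_nec]. Qed.

Lemma dia_mono (A B : form) : IKt2 (A --> B) -> IKt2 (Dia A --> Dia B).
Proof. intro H; eapply d_mp; [apply d_dia_k|now apply d_box_nec]. Qed.

Lemma bdia_mono (A B : form) : IKt2 (A --> B) -> IKt2 (BDia A --> BDia B).
Proof. intro H; eapply d_mp; [apply d_bdia_k|now apply d_bbox_nec]. Qed.

(** [Bot] entails [BBox Bot], and [Dia (BBox Bot)] entails [Bot] by a tense axiom. *)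
Lemma dia_bot : IKt2 (Dia Bot --> Bot).
Proof. eapply imp_trans; [apply dia_mono, bot_elim|apply d_dia_bbox]. Qed.

Lemma bdia_bot : IKt2 (BDia Bot --> Bot).
Proof. eapply imp_trans; [apply bdia_mono, bot_elim|apply d_bdia_box]. Qed.

(** * Stability under double negation *)

Definition stable (A : form) : Prop := IKt2 (Neg (Neg A) --> A).

Lemma stable_neg (A : form) : stable (Neg A).
Proof.
  apply (contrapose A (Neg (Neg A))), dneg_intro.
Qed.

Lemma stable_imp (A B : form) : stable B -> stable (A --> B).
Proof.
  intro H; unfold stable; intro_all. by_thm H. apply ent_intro.
  by_mp (Neg (A --> B)). apply ent_intro. by_mp B. by_mp A.
Qed.

Lemma stable_box (A : form) : stable A -> stable (Box A).
Proof.
  intro H; set (C := Neg (Neg (Box A))).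
  assert (dia_neg : IKt2 (Box A --> Neg (Dia (Neg A)))).
  { eapply imp_trans; [apply box_mono, dneg_intro|].
    intro_all. by_thm dia_bot. eapply ent_mp; [by_thm d_dia_k|hyp]. }
  assert (dia_neg' : IKt2 (Dia (Neg A) --> Neg C)).
  { intro_all. by_mp (Neg (Box A)). apply ent_intro.
    apply ent_mp with (Dia (Neg A)); [by_thm dia_neg|hyp]. }
  assert (bdia_C : IKt2 (BDia C --> Neg (Neg A))).
  { intro_all. by_thm bdia_bot. apply ent_mp with (BDia C); [|hyp].
    by_thm d_bdia_k. by_thm (bbox_mono _ _ dia_neg'). by_thm d_bbox_dia. }
  (* [C] yields [Box (BDia C)], hence the box of ¬¬[A] by [bdia_C]; stability of [A] removes the
     negations under the box. *)
  unfold stable. eapply imp_trans; [apply d_box_bdia|].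
  apply box_mono. eapply imp_trans; eassumption.
Qed.

(** The argument for [Box], with the two tense directions exchanged. *)
Lemma stable_bbox (A : form) : stable A -> stable (BBox A).
Proof.
  intro H; set (C := Neg (Neg (BBox A))).
  assert (bdia_neg : IKt2 (BBox A --> Neg (BDia (Neg A)))).
  { eapply imp_trans; [apply bbox_mono, dneg_intro|].
    intro_all. by_thm bdia_bot. eapply ent_mp; [by_thm d_bdia_k|hyp]. }
  assert (bdia_neg' : IKt2 (BDia (Neg A) --> Neg C)).
  { intro_all. by_mp (Neg (BBox A)). apply ent_intro.
    apply ent_mp with (BDia (Neg A)); [by_thm bdia_neg|hyp]. }
  assert (dia_C : IKt2 (Dia C --> Neg (Neg A))).
  { intro_all. by_thm dia_bot. apply ent_mp with (Dia C); [|hyp].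
    by_thm d_dia_k. by_thm (box_mono _ _ bdia_neg'). by_thm d_box_bdia. }
  unfold stable. eapply imp_trans; [apply d_bbox_dia|].
  apply bbox_mono. eapply imp_trans; eassumption.
Qed.

(** * Quantifier rules with freshness hidden *)

Lemma imp_all (A B : form) :
  (forall p, IKt2 (A --> inst B (Sym p))) -> IKt2 (A --> All B).
Proof.
  intro H; destruct (fresh2 A B) as (p & HA & HB).
  apply d_gen with p; auto; apply H.
Qed.

Lemma imp_imp_all (D E B : form) :
  (forall p, stable (inst B (Sym p))) ->
  (forall p, IKt2 (D --> E --> inst B (Sym p))) ->
  IKt2 (D --> E --> All B).
Proof.
  intros HB H.
  assert (merged : IKt2 (Neg (D --> Neg E) --> All B)).
  { apply imp_all; intro p.
    (* Stability allows assuming the negation of the instance; [D] and [E] derive the instance, so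
       [D --> Neg E] follows, against the merged hypothesis. *)
    eapply imp_trans; [|apply HB]. intro_all.
    by_mp (D --> Neg E). do 2 apply ent_intro.
    by_mp (inst B (Sym p)). apply ent_mp with E; [by_thm (H p)|hyp]. }
  intro_all. by_thm merged. apply ent_intro.
  apply ent_mp with E; [|hyp]. by_mp D.
Qed.

Lemma imp_mono (A A' B B' : form) :
  IKt2 (A' --> A) -> IKt2 (B --> B') -> IKt2 ((A --> B) --> A' --> B').
Proof. intros HA HB; intro_all. by_thm HB. by_mp A. by_thm HA. Qed.

Lemma all_mono (A B : form) :
  (forall p, IKt2 (inst A (Sym p) --> inst B (Sym p))) -> IKt2 (All A --> All B).
Proof. intro H; apply imp_all; intro p; eapply imp_trans; [apply d_comp|apply H]. Qed.

(** The arbitrary [s] lets the induction hypothesis reach instances of a quantified body; variables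
    are harmless because they carry a double negation. *)
Lemma stable_subst_negtr (s : nat -> form) (A : form) : stable (subst s (negtr A)).
Proof.
  revert s; induction A as [p|n|A IHA B IHB|A IHA|A IHA|A IHA]; intro s; simpl.
  - apply stable_neg.
  - apply (stable_neg (Neg (s n))).
  - now apply stable_imp.
  - now apply stable_box.
  - now apply stable_bbox.
  - apply imp_all; intro p; rewrite inst_subst_up.
    eapply imp_trans; [|apply IHA]. do 2 apply contrapose.
    rewrite <- inst_subst_up; apply d_comp.
Qed.

Lemma stable_negtr (A : form) : stable (negtr A).
Proof. rewrite <- subst_var; apply stable_subst_negtr. Qed.

(** * Translation against substitution *)

Lemma negtr_ren (r : nat -> nat) (A : form) : negtr (ren r A) = ren r (negtr A).
Proof.
  revert r; induction A; intro r; simpl; f_equal; auto.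
Qed.

(** Substituted atoms bring no connectives to translate, so commutation is an equality;
    generalisation relies on this. *)
Lemma negtr_subst_atomic (s : nat -> form) (A : form) :
  (forall n, negtr (s n) = Neg (Neg (s n))) ->
  negtr (subst s A) = subst s (negtr A).
Proof.
  revert s; induction A as [p|n|A IHA B IHB|A IHA|A IHA|A IHA];
    intros s H; simpl; auto; f_equal; auto.
  apply IHA; intros [|n]; simpl; auto.
  unfold shift; now rewrite negtr_ren, H.
Qed.

Lemma negtr_inst_sym (A : form) (p : nat) :
  negtr (inst A (Sym p)) = inst (negtr A) (Sym p).
Proof. apply negtr_subst_atomic; now intros [|n]. Qed.

(** [t] is kept apart from [fun n => negtr (s n)] because going under a quantifier
    extends both substitutions by the same symbol. *)
Lemma negtr_subst (s t : nat -> form) (A : form) :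
  (forall n, IKt2 (Neg (Neg (t n)) --> negtr (s n)) /\
             IKt2 (negtr (s n) --> Neg (Neg (t n)))) ->
  IKt2 (subst t (negtr A) --> negtr (subst s A)) /\
  IKt2 (negtr (subst s A) --> subst t (negtr A)).
Proof.
  revert s t; induction A as [p|n|A IHA B IHB|A IHA|A IHA|A IHA];
    intros s t H; simpl.
  - split; apply IKt2_refl.
  - apply H.
  - destruct (IHA s t H), (IHB s t H); split; now apply imp_mono.
  - destruct (IHA s t H); split; now apply box_mono.
  - destruct (IHA s t H); split; now apply bbox_mono.
  (* Instantiating the bound variable by a symbol keeps the hypothesis on [s] and [t] free of
     shifts, so derivability need not be shown invariant under renaming. *)
  - assert (Hp : forall p,
        IKt2 (subst (scons (Sym p) t) (negtr A) -->
              negtr (subst (scons (Sym p) s) A)) /\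
        IKt2 (negtr (subst (scons (Sym p) s) A) -->
              subst (scons (Sym p) t) (negtr A))).
    { intro p; apply IHA; intros [|n]; simpl; [split; apply IKt2_refl|apply H]. }
    split; apply all_mono; intro p;
      rewrite <- negtr_inst_sym, !inst_subst_up; apply Hp.
Qed.

(** Index 0 goes to [C] in one substitution and to [negtr C] in the other; these match up to double
    negation because [negtr C] is stable. *)
Lemma negtr_comp (A C : form) : IKt2 (All (negtr A) --> negtr (inst A C)).
Proof.
  eapply imp_trans; [apply (d_comp _ _ (negtr C))|].
  apply negtr_subst; intros [|n]; simpl.
  - split; [apply stable_negtr|apply dneg_intro].
  - split; apply IKt2_refl.
Qed.

(** * Translated diamonds *)

Lemma negtr_dia_inst (A C : form) :
  inst (negtr (Box (shift A --> BBox (Var 0)) --> Var 0)) C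
  = (Box (negtr A --> BBox (Neg (Neg C))) --> Neg (Neg C)).
Proof.
  unfold shift; simpl; rewrite negtr_ren. fold (shift (negtr A)).
  unfold inst; simpl. fold (inst (shift (negtr A)) C). now rewrite inst_shift.
Qed.

Lemma negtr_bdia_inst (A C : form) :
  inst (negtr (BBox (shift A --> Box (Var 0)) --> Var 0)) C
  = (BBox (negtr A --> Box (Neg (Neg C))) --> Neg (Neg C)).
Proof.
  unfold shift; simpl; rewrite negtr_ren. fold (shift (negtr A)).
  unfold inst; simpl. fold (inst (shift (negtr A)) C). now rewrite inst_shift.
Qed.

(** The variable bound in a diamond acquires a double negation, so instantiating [negtr (Dia A)]
    reaches only doubly negated targets. *)
Lemma negtr_dia_elim (A C : form) :
  IKt2 (negtr (Dia A) --> Box (negtr A --> BBox (Neg (Neg C))) --> Neg (Neg C)).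
Proof. rewrite <- negtr_dia_inst; apply d_comp. Qed.

Lemma negtr_bdia_elim (A C : form) :
  IKt2 (negtr (BDia A) --> BBox (negtr A --> Box (Neg (Neg C))) --> Neg (Neg C)).
Proof. rewrite <- negtr_bdia_inst; apply d_comp. Qed.

Lemma imp_compose (A B C : form) : IKt2 ((A --> B) --> (B --> C) --> A --> C).
Proof. intro_all. by_mp B. by_mp A. Qed.

(** Composing implications under the box turns a test of [negtr B] against a target into one of
    [negtr A]. The targets are stable, so both side formulas can be merged. *)
Lemma negtr_dia_k (A B : form) :
  IKt2 (Box (negtr A --> negtr B) --> negtr (Dia A) --> negtr (Dia B)).
Proof.
  apply (imp_imp_all _ _ (negtr (Box (shift B --> BBox (Var 0)) --> Var 0)));
    intro p; rewrite negtr_dia_inst.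
  - apply stable_imp, stable_neg.
  - apply ent_nil; do 3 apply ent_intro.
    eapply ent_mp; [by_thm (negtr_dia_elim A (Sym p))|].
    eapply ent_mp; [by_thm d_box_k|hyp].
    by_thm (box_mono _ _ (imp_compose (negtr A) (negtr B) (BBox (Neg (Neg (Sym p)))))).
Qed.

Lemma negtr_bdia_k (A B : form) :
  IKt2 (BBox (negtr A --> negtr B) --> negtr (BDia A) --> negtr (BDia B)).
Proof.
  apply (imp_imp_all _ _ (negtr (BBox (shift B --> Box (Var 0)) --> Var 0)));
    intro p; rewrite negtr_bdia_inst.
  - apply stable_imp, stable_neg.
  - apply ent_nil; do 3 apply ent_intro.
    eapply ent_mp; [by_thm (negtr_bdia_elim A (Sym p))|].
    eapply ent_mp; [by_thm d_bbox_k|hyp].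
    by_thm (bbox_mono _ _ (imp_compose (negtr A) (negtr B) (Box (Neg (Neg (Sym p)))))).
Qed.

Lemma dia_inst (A C : form) :
  IKt2 (Dia A --> Box (A --> BBox C) --> C).
Proof.
  rewrite <- (inst_shift A C) at 2.
  exact (d_comp _ (Box (shift A --> BBox (Var 0)) --> Var 0) C).
Qed.

Lemma bdia_inst (A C : form) :
  IKt2 (BDia A --> BBox (A --> Box C) --> C).
Proof.
  rewrite <- (inst_shift A C) at 2.
  exact (d_comp _ (BBox (shift A --> Box (Var 0)) --> Var 0) C).
Qed.

(** The doubly negated targets on the right are among the targets that [Dia (negtr A)] already
    serves. *)
Lemma dia_negtr (A : form) : IKt2 (Dia (negtr A) --> negtr (Dia A)).
Proof.
  apply (imp_all _ (negtr (Box (shift A --> BBox (Var 0)) --> Var 0)));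
    intro p; rewrite negtr_dia_inst; apply dia_inst.
Qed.

Lemma bdia_negtr (A : form) : IKt2 (BDia (negtr A) --> negtr (BDia A)).
Proof.
  apply (imp_all _ (negtr (BBox (shift A --> Box (Var 0)) --> Var 0)));
    intro p; rewrite negtr_bdia_inst; apply bdia_inst.
Qed.

(** With target [negtr A] the boxed premise is a theorem, and stability strips the double negation
    obtained. *)
Lemma negtr_dia_bbox (A : form) : IKt2 (negtr (Dia (BBox A)) --> negtr A).
Proof.
  eapply imp_trans; [|apply stable_negtr]. apply ent_nil, ent_intro.
  apply ent_mp with (Box (negtr (BBox A) --> BBox (Neg (Neg (negtr A)))));
    [by_thm negtr_dia_elim|].
  apply ent_thm, d_box_nec, bbox_mono, dneg_intro.
Qed.

Lemma negtr_bdia_box (A : form) : IKt2 (negtr (BDia (Box A)) --> negtr A).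
Proof.
  eapply imp_trans; [|apply stable_negtr]. apply ent_nil, ent_intro.
  apply ent_mp with (BBox (negtr (Box A) --> Box (Neg (Neg (negtr A)))));
    [by_thm negtr_bdia_elim|].
  apply ent_thm, d_bbox_nec, box_mono, dneg_intro.
Qed.

(** * Falsity and the classical axiom *)

Lemma negtr_bot : IKt2 (negtr Bot --> Bot).
Proof.
  (* [negtr Bot] is ∀X ¬¬X; at [Bot] this is ¬¬[Bot], and ¬[Bot] is an identity implication. *)
  eapply imp_trans; [apply (d_comp _ (Neg (Neg (Var 0))) Bot)|].
  intro_all. eapply ent_mp; [hyp|]. apply ent_thm, IKt2_refl.
Qed.

Lemma negtr_dneg (A : form) : IKt2 (negtr (Neg (Neg A)) --> negtr A).
Proof.
  eapply imp_trans; [|apply stable_negtr].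
  apply imp_mono; [|apply negtr_bot].
  apply imp_mono; [apply IKt2_refl|apply bot_elim].
Qed.

Theorem theorem8p2 (A : form) : Kt2 A -> IKt2 (negtr A).
Proof.
  induction 1 as [A B|A B C|A C|p A B HA HB _ IH|A B _ IH1 _ IH2|A B|A B|A B|A B
                 |A _ IH|A _ IH|A|A|A|A|F [A ->]].
  - apply d_k.
  - apply d_s.
  - apply negtr_comp.
  (* The translation adds no symbols, so [p] stays fresh. *)
  - apply d_gen with p; [intro H; now apply HA, occurs_negtr
                        |intro H; now apply HB, occurs_negtr|].
    rewrite <- negtr_inst_sym; exact IH.
  - now apply d_mp with (negtr A).
  - apply d_box_k.
  - apply negtr_dia_k.
  - apply d_bbox_k.
  - apply negtr_bdia_k.
  - now apply d_box_nec.
  - now apply d_bbox_nec.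
  - apply negtr_bdia_box.
  - exact (imp_trans _ _ _ (d_box_bdia _ _) (box_mono _ _ (bdia_negtr A))).
  - apply negtr_dia_bbox.
  - exact (imp_trans _ _ _ (d_bbox_dia _ _) (bbox_mono _ _ (dia_negtr A))).
  - apply negtr_dneg.
Qed.
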